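(* The Set-Restricted Disjoint Paths and Set-Restricted Totally Disjoint Paths problems on split graphs, parameterized by the number $k$ of terminal pairs, admit kernels on $\mathcal{O}(k^2)$ vertices.
   Context: All graphs are finite, simple and undirected. A graph is a split graph if its vertex set can be partitioned into a clique and an independent set. Two paths, an $(s_1,t_1)$-path $P_1$ and an $(s_2,t_2)$-path $P_2$, are internally vertex-disjoint if for $i\in\{1,2\}$, $(V(P_i)\setminus\{s_i,t_i\})\cap V(P_{3-i})=\emptyset$. Set-Restricted Disjoint Paths: the input is a graph $G$, a set $\mathcal{X}=\{(s_1,t_1),\dots,(s_k,t_k)\}$ of $k$ pairs of vertices of $G$ (terminals; different indices may have the same pair), and $\mathcal{U}=\{U_1,\dots,U_k\}$ of $k$ vertex subsets of $G$ (domains). The question is whether $G$ contains $k$ pairwise internally vertex-disjoint paths $P_1,\dots,P_k$ such that for each $i$, $P_i$ is an $(s_i,t_i)$-path with $V(P_i)\subseteq U_i$. Set-Restricted Totally Disjoint Paths is the same problem, except that $P_1,\dots,P_k$ are additionally required to be pairwise distinct. A kernel on $f(k)$ vertices for a problem on a graph class is a polynomial-time algorithm mapping each instance with parameter $k$ (whose graph is in the class) to an equivalent instance of the same problem (on the same class) whose graph has at most $f(k)$ vertices and whose parameter is bounded by a function of $k$. *)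

(* Defs.v *)
From mathcomp Require Import all_boot.

Set Implicit Arguments.
Unset Strict Implicit.
Unset Printing Implicit Defensive.

(** * Graphs and paths *)

Record sgraph := SGraph {
  nverts : nat;
  adj : rel 'I_nverts;
  adj_sym : symmetric adj;
  adj_irr : irreflexive adj
}.

Notation vertex G := 'I_(nverts G).

Definition clique (G : sgraph) (C : {set vertex G}) : Prop :=
  {in C &, forall u v, u != v -> adj u v}.

Definition independent (G : sgraph) (S : {set vertex G}) : Prop :=
  {in S &, forall u v, ~~ adj u v}.

Definition split_graph (G : sgraph) : Prop :=
  exists C S : {set vertex G},
    [/\ C :|: S = setT, C :&: S = set0, clique C & independent S].

(* A path is the sequence of its vertices; if [s = t], the only
   (s,t)-path is [[:: s]]. *)
Definition st_path (G : sgraph) (s t : vertex G) (p : seq (vertex G)) : bool :=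
  if p is x :: q then [&& x == s, last x q == t, path (@adj G) x q & uniq p]
  else false.

Definition path_edges (G : sgraph) (p : seq (vertex G)) : {set {set vertex G}} :=
  [set [set e.1; e.2] | e in zip p (behead p)].

(* Paths of an undirected graph are compared as subgraphs, so that traversing
   a path backwards yields the same path. *)
Definition same_path (G : sgraph) (p q : seq (vertex G)) : Prop :=
  p =i q /\ path_edges p = path_edges q.

(** * The problems *)

Record instance := Instance {
  igraph : sgraph;
  npairs : nat;
  src : 'I_npairs -> vertex igraph;
  tgt : 'I_npairs -> vertex igraph;
  domain : 'I_npairs -> {set vertex igraph}
}.

Definition restricted_paths (I : instance)
    (P : 'I_(npairs I) -> seq (vertex (igraph I))) : Prop :=
  forall i, st_path (src i) (tgt i) (P i) /\ {subset P i <= domain i}.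

(* One inclusion per ordered pair [(i, j)], hence both conditions for each
   unordered pair of paths. *)
Definition internally_disjoint (I : instance)
    (P : 'I_(npairs I) -> seq (vertex (igraph I))) : Prop :=
  forall i j, i != j ->
    forall v, v \in P i -> v != src i -> v != tgt i -> v \notin P j.

Definition pairwise_distinct (I : instance)
    (P : 'I_(npairs I) -> seq (vertex (igraph I))) : Prop :=
  forall i j, i != j -> ~ same_path (P i) (P j).

Definition set_restricted_disjoint_paths (I : instance) : Prop :=
  exists P, @restricted_paths I P /\ internally_disjoint P.

Definition set_restricted_totally_disjoint_paths (I : instance) : Prop :=
  exists P, [/\ @restricted_paths I P, internally_disjoint P
              & pairwise_distinct P].

(** * Polynomial time *)

(* Programs of a random access machine whose memory consists of arrays of
   natural numbers ([st a i] is cell [i] of array [a]), with indirect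
   addressing.  A program has a fixed size, so it uses a fixed number of arrays
   and evaluates expressions of bounded size; each assignment and each test has
   unit cost.  There is no multiplication, so a step lengthens the binary
   representation of the largest number in memory by at most a constant number
   of bits, and polynomial time here agrees with polynomial time on Turing
   machines. *)
Inductive expr :=
  | Const of nat
  | Cell of nat & expr
  | Add of expr & expr
  | Sub of expr & expr.

Inductive cmd :=
  | Skip
  | Assign of nat & expr & expr
  | Seq of cmd & cmd
  | If of expr & cmd & cmd
  | While of expr & cmd.

Definition state := nat -> nat -> nat.

Fixpoint eval (st : state) (e : expr) : nat :=
  match e with
  | Const n => n
  | Cell a e1 => st a (eval st e1)
  | Add e1 e2 => eval st e1 + eval st e2
  | Sub e1 e2 => eval st e1 - eval st e2
  end.

Definition update (st : state) (a i x : nat) : state :=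
  fun b j => if (b == a) && (j == i) then x else st b j.

(* [exec c st m st']: started in [st], [c] halts in [st'] after [m] steps. *)
Inductive exec : cmd -> state -> nat -> state -> Prop :=
  | ExecSkip st : exec Skip st 1 st
  | ExecAssign st a e1 e2 :
      exec (Assign a e1 e2) st 1 (update st a (eval st e1) (eval st e2))
  | ExecSeq c1 c2 st m1 st1 m2 st2 :
      exec c1 st m1 st1 -> exec c2 st1 m2 st2 ->
      exec (Seq c1 c2) st (m1 + m2) st2
  | ExecIfTrue e c1 c2 st m st1 :
      eval st e != 0 -> exec c1 st m st1 -> exec (If e c1 c2) st m.+1 st1
  | ExecIfFalse e c1 c2 st m st1 :
      eval st e = 0 -> exec c2 st m st1 -> exec (If e c1 c2) st m.+1 st1
  | ExecWhileFalse e c st :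
      eval st e = 0 -> exec (While e c) st 1 st
  | ExecWhileTrue e c st m1 st1 m2 st2 :
      eval st e != 0 -> exec c st m1 st1 -> exec (While e c) st1 m2 st2 ->
      exec (While e c) st (m1 + m2).+1 st2.

(* The input is on array 0; all other cells are initially 0. *)
Definition initial (w : seq nat) : state :=
  fun a i => if a == 0 then nth 0 w i else 0.

(* The output is read on array 1; [encode] below determines its own length. *)
Definition outputs (st : state) (w : seq nat) : Prop :=
  forall i, i < size w -> st 1 i = nth 0 w i.

(* Number of vertices, number of pairs, adjacency matrix by rows, the pairs,
   and the characteristic vectors of the domains. *)
Definition encode (I : instance) : seq nat :=
  let V := enum (vertex (igraph I)) in
  let K := enum 'I_(npairs I) in
  [:: nverts (igraph I); npairs I]
  ++ [seq nat_of_bool (adj u v) | u <- V, v <- V]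
  ++ flatten [seq [:: nat_of_ord (src i); nat_of_ord (tgt i)] | i <- K]
  ++ [seq nat_of_bool (v \in domain i) | i <- K, v <- V].

(** * Kernels *)

Definition admits_kernel (C : sgraph -> Prop) (Q : instance -> Prop)
    (f : nat -> nat) : Prop :=
  exists (prog : cmd) (c d : nat) (g : nat -> nat),
    forall I : instance, C (igraph I) ->
      exists (m : nat) (st : state) (I' : instance),
        [/\ exec prog (initial (encode I)) m st,
            m <= c * size (encode I) ^ d + c
          & outputs st (encode I')] /\
        [/\ C (igraph I'), Q I <-> Q I',
            nverts (igraph I') <= f (npairs I)
          & npairs I' <= g (npairs I)].

Definition bigO (f h : nat -> nat) : Prop :=
  exists c k0 : nat, forall k, k0 <= k -> f k <= c * h k.

(* Main.v *)
Require Import Defs.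
From mathcomp Require Import all_boot order zify.

(** Both problems have a kernel that is an induced subgraph, with the same pairs.

    In a split graph every path can be shortened within its own vertex set to
    one with at most two internal vertices, without losing its last internal
    vertex; two internal vertices are needed only between nonadjacent ends in the
    independent set ([shorten]).  Hence an internal vertex of the path of pair [i]
    plays one of three parts: common neighbour of the two ends, or neighbour of
    one end in the clique.  For each part keep the first [4 * k] vertices of the
    domain that can play it, together with all terminals: at most
    [k * (12 * k + 2)] vertices ([card_kernel_set]).  If a solution uses a vertex
    that was not kept, then [4 * k] candidates for its part were kept, fewer than
    [4 * k] of them are occupied, and a free one can be used instead
    ([exchange]).  So a solution can be moved into the kernel
    ([solution_kernel]), and conversely solutions of the induced instance are
    solutions of the original one ([problem_induced]).
    Paths with an internal vertex are automatically distinct from all others, so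
    the same argument serves the version with distinct paths.

    For the algorithm, each cell of the encoding of the kernel is a term built
    from input cells by arithmetic and bounded sums: the new name of a vertex is
    the number of smaller kept vertices, and being kept is a counting condition.
    Such terms compile to programs that run in polynomial time
    ([compile_correct]), and a loop tabulates them ([table_program_correct]). *)

Set Implicit Arguments.
Unset Strict Implicit.
Unset Printing Implicit Defensive.

Import Order.TTheory.

(** * Finite sets: least elements and cardinalities *)

Section FirstElements.
Variable n : nat.
Implicit Types (A : {set 'I_n}) (v : 'I_n).

Definition below A (m : nat) : {set 'I_n} := [set u in A | u < m].

Definition first_elements m A : {set 'I_n} := [set v in A | #|below A v| < m].

(** The largest of the first [m] elements has all the others below it. *)
Lemma card_first_elements_le m A : #|first_elements m A| <= m.
Proof.
have [->|[v0 v0F]] := set_0Vmem (first_elements m A); first by rewrite cards0.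
have [v vF max_v] := @arg_maxnP _ v0 [in first_elements m A] val v0F.
rewrite /= in vF.
have [vA lt_m] : v \in A /\ #|below A v| < m by apply/andP; move: vF; rewrite inE.
apply: leq_trans lt_m; rewrite (cardsD1 v) vF ltnS.
apply/subset_leq_card/subsetP => u; rewrite !inE => /and3P[uv uA ru].
rewrite uA ltn_neqAle uv; apply: max_v.
by rewrite /= inE uA.
Qed.

(** An element that is left out witnesses that [A] is large.  The least
    left-out element [u] has at least [m] elements of [A] below it, and all of
    these are among the first ones by minimality of [u]. *)
Lemma card_first_elements_ge m A v :
  v \in A -> v \notin first_elements m A -> m <= #|first_elements m A|.
Proof.
move=> vA vF; have Pv : (v \in A) && (v \notin first_elements m A) by rewrite vA.
pose left_out := [pred v | (v \in A) && (v \notin first_elements m A)].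
have [u /andP[uA uF] min_u] := @arg_minnP _ v left_out val Pv.
have: m <= #|below A u| by move: uF; rewrite inE uA /= -leqNgt.
move/leq_trans; apply; apply/subset_leq_card/subsetP => w.
rewrite inE => /andP[wA lt_w]; apply: contraLR lt_w => wF.
by rewrite -leqNgt; apply: min_u; rewrite /= wA.
Qed.

End FirstElements.

Lemma card_bigcup_le (J T : finType) (F : J -> {set T}) m :
  (forall i, #|F i| <= m) -> #|\bigcup_i F i| <= #|J| * m.
Proof.
move=> Fm; rewrite -sum_nat_const.
apply: leq_trans (_ : \sum_i #|F i| <= _); last exact: leq_sum.
elim/big_rec2: _ => [|i a A _ IH]; first by rewrite cards0.
apply: leq_trans (leq_card_setU _ _) _; by rewrite leq_add2l.
Qed.

Lemma card_setU_le (T : finType) (A B : {set T}) a b :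
  #|A| <= a -> #|B| <= b -> #|A :|: B| <= a + b.
Proof.
by move=> Aa Bb; apply: leq_trans (leq_card_setU A B) (leq_add Aa Bb).
Qed.

(** * Solutions and their internal vertices *)

Section Solutions.
Variable I : instance.
Notation G := (igraph I).
Notation V := (vertex G).
Notation J := 'I_(npairs I).
Implicit Types (P : J -> seq V) (b : bool).

(** Both problems at once: [b] tells whether the paths must be distinct.
    Distinctness is expressed by vertex sets only, which [problemE] justifies. *)
Definition solution b P : Prop :=
  [/\ restricted_paths P, internally_disjoint P
    & b -> forall i j, i != j -> ~ P i =i P j].

Lemma st_path_ends (s t : V) p : st_path s t p -> s \in p /\ t \in p.
Proof.
case: p => //= x p /and4P[/eqP<- /eqP<- _ _].
by rewrite mem_head mem_last.
Qed.

Lemma st_path_no_inner (s t : V) p :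
  st_path s t p -> {subset p <= [:: s; t]} ->
  p = if s == t then [:: s] else [:: s; t].
Proof.
case: p => //= x p /and4P[/eqP-> + _ /=].
case: p => [|y [|z p]] /=; first by move/eqP->; rewrite eqxx.
  by move=> /eqP->; rewrite inE andbT => /negPf->.
move=> _ /and3P[+ + _] sub.
have := sub y; have := sub z; rewrite !inE !eqxx !orbT.
move=> /(_ isT) Hz /(_ isT) Hy; rewrite !negb_or => /and3P[sy sz _] /andP[yz _].
move: Hz Hy; rewrite ![_ == s]eq_sym (negPf sy) (negPf sz) /= => /eqP zt /eqP yt.
by rewrite yt zt eqxx in yz.
Qed.

(** A common vertex of two paths of a solution is an end of both.  Hence two
    paths on the same vertex set have no internal vertex: they are equal to a
    single vertex or to a single edge, possibly traversed in opposite
    directions, and then their edges agree too. *)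
Lemma same_path_mem P i j :
    restricted_paths P -> internally_disjoint P -> i != j ->
  P i =i P j -> same_path (P i) (P j).
Proof.
move=> rP dP ij eP; split=> //.
have no_inner i' j' : i' != j' -> P i' =i P j' ->
    {subset P i' <= [:: src i'; tgt i']}.
  move=> ij' eP' v vP; rewrite !inE; apply: contraT; rewrite negb_or.
  by case/andP=> vs vt; have := dP _ _ ij' _ vP vs vt; rewrite -eP' vP.
have ji : j != i by rewrite eq_sym.
have eP' : P j =i P i by move=> v; rewrite eP.
have [[pi _] [pj _]] := (rP i, rP j).
have Ei := st_path_no_inner pi (no_inner _ _ ij eP).
have Ej := st_path_no_inner pj (no_inner _ _ ji eP').
move: eP; rewrite Ei Ej; case: eqP => [ei | nei]; case: eqP => [ej | nej] eP.
- by have := eP (src i); rewrite !inE eqxx => /esym/eqP->.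
- have := eP (src j); have := eP (tgt j); rewrite !inE !eqxx orbT.
  by move=> /eqP e1 /eqP e2; case: nej; rewrite e1 e2.
- have := eP (src i); have := eP (tgt i); rewrite !inE !eqxx orbT.
  by move=> /esym/eqP e1 /esym/eqP e2; case: nei; rewrite e1 e2.
- suff e : [set src i; tgt i] = [set src j; tgt j].
    rewrite /path_edges /=; apply/setP=> e'; apply/imsetP/imsetP.
    + case=> x; rewrite inE => /eqP-> ->.
      by exists (src j, tgt j); rewrite ?mem_head //= e.
    + case=> x; rewrite inE => /eqP-> ->.
      by exists (src i, tgt i); rewrite ?mem_head //= -e.
  by apply/setP=> v; have := eP v; rewrite !inE.
Qed.

Definition problem b : Prop :=
  if b then set_restricted_totally_disjoint_paths I
  else set_restricted_disjoint_paths I.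

Lemma problemE b : problem b <-> exists P, solution b P.
Proof.
case: b; split=> [[P]|[P []]].
- move=> [rP dP xP]; exists P; split=> // _ i j ij eP.
  exact: xP ij (same_path_mem rP dP ij eP).
- move=> rP dP xP; exists P; split=> // i j ij [eP _]; exact: xP isT _ _ ij eP.
- by move=> [rP dP]; exists P.
- by move=> rP dP _; exists P.
Qed.

Definition terminals : {set V} := \bigcup_i [set src i; tgt i].

Lemma terminalsP v :
  reflect (exists i : J, v = src i \/ v = tgt i) (v \in terminals).
Proof.
apply: (iffP bigcupP) => [[i _]|[i vi]]; last exists i => //.
  by rewrite !inE => H; exists i; case/orP: H => /eqP; [left | right].
by rewrite !inE; case: vi => ->; rewrite eqxx ?orbT.
Qed.

(** * Short paths in split graphs *)

Section Split.
Variable S : {set V}.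
Hypotheses (S_indep : independent S) (C_clique : clique (~: S)).

Lemma adj_S u v : adj u v -> u \in S -> v \notin S.
Proof. by move=> uv uS; apply: contraL uv; exact: S_indep. Qed.

(** The possible lists of internal vertices after shortening.  Two internal
    vertices are allowed only between two ends in the independent set; their
    adjacency is then automatic, since neighbours of the ends lie in the
    clique. *)
Definition short (s t : V) (q : seq V) : bool :=
  match q with
  | [::] => (s == t) || adj s t
  | [:: u] => [&& s != t, adj s u & adj t u]
  | [:: u; v] => [&& s != t, s \in S, t \in S, adj s u, adj t v & u != v]
  | _ => false
  end.

Lemma short_size s t q : short s t q -> size q <= 2.
Proof. by case: q => [|u [|v []]]. Qed.

(** Let [u] and [v] be the first and the last of at least two internal
    vertices.  If [s] and [t] are both in the independent set, [u] and [v] are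
    in the clique and [s, u, v, t] is a path.  If only [t] is, [v] is in the
    clique together with [s], so [v] alone suffices; symmetrically [u] if only
    [s] is.  If [s] and [t] are both in the clique, [u] suffices unless it is
    independent, and then the vertex after [u] is in the clique and suffices.
    A path with an internal vertex keeps one: otherwise two paths between the
    same ends could become equal. *)
Lemma shorten s t p : st_path s t p ->
  exists q, [/\ short s t q, {subset q <= p}, s \notin q, t \notin q
              & q = [::] -> p =i [:: s; t]].
Proof.
case: p => //= x p /and4P[/eqP-> {x}].
case/lastP: p => [|p x] /=.
  move=> /eqP-> _ _; exists [::]; split; rewrite /= ?eqxx // => _ v.
  by rewrite !inE orbb.
rewrite last_rcons rcons_path rcons_uniq mem_rcons inE.
move=> /eqP-> {x} /andP[pth last_t] /andP[+ /andP[tp up]].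
rewrite negb_or => /andP[st sp].
case: p pth last_t tp up sp => [|u p] /=.
  by move=> _ st' _ _ _; exists [::]; split; rewrite /= ?st' ?orbT.
move=> /andP[su pth] last_t; rewrite !inE !negb_or.
move=> /andP[tu tp] /andP[up _] /andP[su' sp].
have vin v : v \in u :: p -> v \in s :: rcons (u :: p) t.
  by rewrite -cats1 !(inE, mem_cat) => /orP[->|->]; rewrite ?orbT.
have one v : v \in u :: p -> adj s v -> adj t v -> s != v -> t != v ->
    exists q, [/\ short s t q, {subset q <= s :: u :: rcons p t}, s \notin q,
      t \notin q & q = [::] -> s :: u :: rcons p t =i [:: s; t]].
  move=> vp sv tv sv' tv'; exists [:: v]; split=> //; rewrite ?inE //=.
    by rewrite st sv.
  by move=> w; rewrite inE => /eqP->; exact: vin.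
have adj_C a c : a \notin S -> c \notin S -> a != c -> adj a c.
  by move=> aS cS; apply: C_clique; rewrite inE.
case: (boolP (p == [::])) => [/eqP p0|pn0].
  apply: (one u) => //; rewrite ?mem_head // adj_sym.
  by rewrite p0 in last_t.
set v := last u p in last_t.
have vp : v \in p by rewrite /v; case: (p) pn0 => //= a l _; exact: mem_last.
have [sv tv] : s != v /\ t != v.
  by split; [apply: contraNneq sp => -> | apply: contraNneq tp => ->].
have vup : v \in u :: p by rewrite inE vp orbT.
have uv : u != v by apply: contraNneq up => ->.
rewrite adj_sym in last_t.
case: (boolP (s \in S)) => sS; case: (boolP (t \in S)) => tS.
- exists [:: u; v]; split; rewrite ?inE ?negb_or ?su' ?tu ?sv ?tv //=.
    by rewrite st sS tS su last_t uv.
  move=> w; rewrite !inE => /orP[] /eqP->; apply: vin => //; exact: mem_head.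
- apply: (one u) => //; first exact: mem_head.
  by apply: adj_C => //; apply: adj_S su sS.
- apply: (one v) => //; apply: adj_C => //; exact: adj_S last_t tS.
- case: (boolP (u \in S)) => uS; last first.
    by apply: (one u) => //; [exact: mem_head | exact: adj_C].
  case: p pth pn0 {v last_t vp sv tv vup uv up vin} one tp sp => //= w p.
  move=> /andP[uw _] _ one; rewrite !inE !negb_or => /andP[tw _] /andP[sw _].
  have wS := adj_S uw uS.
  by apply: (one w) => //; [rewrite !inE eqxx orbT | exact: adj_C | exact: adj_C].
Qed.

Definition route (s t : V) (q : seq V) :=
  if s == t then [:: s] else s :: rcons q t.

Lemma mem_route s t q v : short s t q ->
  (v \in route s t q) = [|| v == s, v == t | v \in q].
Proof.
rewrite /route; case: eqP => [->|_ _]; last by rewrite inE mem_rcons inE.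
by case: q => [|u [|u' []]] //=; rewrite ?eqxx // !inE orbF orbb.
Qed.

Lemma st_path_route s t q :
  short s t q -> s \notin q -> t \notin q -> st_path s t (route s t q).
Proof.
rewrite /route; case: eqP => [->|/eqP st] /=; first by rewrite !eqxx.
rewrite eqxx last_rcons eqxx rcons_path mem_rcons inE rcons_uniq.
rewrite (negPf st) /= => sq -> ->; move: sq => /=.
case: q => [|u [|v []]] //=; rewrite ?(negPf st) /= ?andbT //.
  by rewrite [adj u t]adj_sym.
case/and5P=> sS tS su tv uv.
rewrite su [adj v t]adj_sym tv inE uv !andbT.
by apply: C_clique; rewrite // inE; [apply: adj_S su sS | apply: adj_S tv tS].
Qed.

(** Solutions in terms of internal vertices.  Since a terminal lies on a path
    of its own, internal vertices are never terminals, not even of other pairs.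
    Paths with an internal vertex are distinct from all others, so distinctness
    only concerns pairs of paths without internal vertices. *)
Definition inner_solution b (q : J -> seq V) : Prop :=
  [/\ forall i, short (src i) (tgt i) (q i),
      forall i, [/\ src i \in domain i, tgt i \in domain i
                  & {subset q i <= domain i}],
      forall i v, v \in q i -> v \notin terminals,
      forall i j, i != j -> forall v, v \in q i -> v \notin q j
    & b -> forall i j, i != j -> q i = [::] -> q j = [::] ->
        [set src i; tgt i] != [set src j; tgt j]].

Lemma solution_inner b P : solution b P -> exists q, inner_solution b q.
Proof.
move=> [rP dP xP].
have [q qP] := fin_all_exists (fun i => shorten (proj1 (rP i))).
have inner i v : v \in q i -> [/\ v \in P i, v != src i & v != tgt i].
  move=> vq; have [_ sub sq tq _] := qP i; split; first exact: sub.
    by apply: contraNneq sq => <-.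
  by apply: contraNneq tq => <-.
exists q; split=> [i | i | i v vq | i j ij v vq | bT i j ij qi qj].
- by case: (qP i).
- have [/st_path_ends[s_in t_in] sub] := rP i.
  by split; try exact: sub; move=> v /inner[vP _ _]; exact: sub.
- have [vP vs vt] := inner _ _ vq; apply/terminalsP=> -[j vj].
  have [/st_path_ends[s_in t_in] sub] := rP j.
  case: (eqVneq i j) vj => [<-|ij] vj.
    by case: vj => vj; rewrite vj eqxx in vs vt.
  by have := dP i j ij v vP vs vt; case: vj => ->; rewrite ?s_in ?t_in.
- have [vP vs vt] := inner _ _ vq; apply: contra (dP i j ij v vP vs vt).
  by case/inner.
- apply/eqP=> /setP e; apply: (xP bT _ _ ij) => v.
  have [_ _ _ _ /(_ qi) ->] := qP i; have [_ _ _ _ /(_ qj) ->] := qP j.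
  by have := e v; rewrite !inE.
Qed.

Lemma src_terminal i : src i \in terminals.
Proof. by apply/terminalsP; exists i; left. Qed.

Lemma tgt_terminal i : tgt i \in terminals.
Proof. by apply/terminalsP; exists i; right. Qed.

Lemma inner_solution_route b q : inner_solution b q ->
  solution b (fun i => route (src i) (tgt i) (q i)).
Proof.
move=> [sq dq tq xq bq]; split=> [i | i j ij v | bT i j ij e].
- have [sd td sub] := dq i; split.
    apply: st_path_route => //; apply/negP=> /tq.
      by rewrite src_terminal.
    by rewrite tgt_terminal.
  by move=> v; rewrite mem_route // => /or3P[/eqP->|/eqP->|/sub].
- rewrite mem_route // => + vs vt; rewrite (negPf vs) (negPf vt) /= => vq.
  rewrite mem_route // !negb_or (xq _ _ ij) // !andbT.
  by apply/andP; split; apply: contraNneq (tq _ _ vq) => ->;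
    rewrite ?src_terminal ?tgt_terminal.
- have nil i' j' : i' != j' ->
      route (src i') (tgt i') (q i') =i route (src j') (tgt j') (q j') ->
      q i' = [::].
    move=> ij' e'; case Eq: (q i') => [//|v r].
    have vq : v \in q i' by rewrite Eq mem_head.
    have := e' v; rewrite !mem_route // vq !orbT (negPf (xq _ _ ij' _ vq)) orbF.
    by case/esym/orP=> /eqP ev; have := tq _ _ vq;
      rewrite ev ?src_terminal ?tgt_terminal.
  have qi := nil _ _ ij e; have ji : j != i by rewrite eq_sym.
  have qj := nil _ _ ji (fun v => esym (e v)).
  have /eqP[] := bq bT _ _ ij qi qj; apply/setP=> v.
  by have := e v; rewrite !mem_route // qi qj !inE !orbF.
Qed.

(** * The vertices of the kernel *)

(** The vertices that can play a given part in the path of pair [i]: the only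
    internal vertex when [x] and [y] are its two ends, and the first or the last
    of two internal vertices when [x = y] is the corresponding end. *)
Definition candidates (i : J) (x y : V) : {set V} :=
  [set v | [&& adj x v, adj y v & v \in domain i]].

(** A solution with at most two internal vertices per path occupies at most
    [4 * npairs I] vertices, terminals included. *)
Definition marked i x y := first_elements (4 * npairs I) (candidates i x y).

Definition pair_set (i : J) : {set V} :=
  [set src i; tgt i] :|: (marked i (src i) (tgt i) :|:
    (marked i (src i) (src i) :|: marked i (tgt i) (tgt i))).

Definition kernel_set : {set V} := \bigcup_i pair_set i.

Lemma card_kernel_set : #|kernel_set| <= npairs I * (12 * npairs I + 2).
Proof.
rewrite -{1}(card_ord (npairs I)); apply: card_bigcup_le => i.
have m x y : #|marked i x y| <= 4 * npairs I by exact: card_first_elements_le.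
have m1 := m (src i) (tgt i); have m2 := m (src i) (src i).
have {m} m3 := m (tgt i) (tgt i).
have -> : 12 * npairs I + 2 = 2 + (4 * npairs I + (4 * npairs I + 4 * npairs I)).
  by lia.
rewrite /pair_set; apply: card_setU_le; last first.
  by apply: card_setU_le => //; exact: card_setU_le.
by rewrite cards2; case: eqP.
Qed.

Lemma terminals_kernel v : v \in terminals -> v \in kernel_set.
Proof.
case/bigcupP=> i _ vi; apply/bigcupP; exists i => //.
by rewrite inE vi.
Qed.


(** * The exchange argument *)

Definition swap (v v' : V) (r : seq V) := [seq if z == v then v' else z | z <- r].

Lemma mem_swap v v' r z : z \in swap v v' r -> z = v' \/ z \in r.
Proof. by case/mapP=> u ur ->; case: eqP => _; [left | right]. Qed.

Lemma count_swap (a : pred V) v v' r :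
  a v -> ~~ a v' -> count a (swap v v' r) + count_mem v r = count a r.
Proof.
move=> av av'; elim: r => //= u r IH.
case: eqP => [->|_] /=; rewrite -IH; last by lia.
by rewrite av (negPf av'); lia.
Qed.

(** Every internal vertex [v] is a candidate for its part, and any other
    candidate can take its place.  In the case of two internal vertices this
    relies on the ends being in the independent set: every candidate is then in
    the clique, hence adjacent to the other internal vertex. *)
Lemma short_swap i r v :
    short (src i) (tgt i) r -> {subset r <= domain i} -> v \in r ->
  exists2 A : {set V},
      [/\ v \in A, A \subset domain i,
         first_elements (4 * npairs I) A \subset kernel_set &
         v \notin kernel_set -> v \notin first_elements (4 * npairs I) A]
    & forall v', v' \in A -> v' \notin r -> short (src i) (tgt i) (swap v v' r).
Proof.
move=> sr rd vr.
have K x y : marked i x y \subset pair_set i -> v \in candidates i x y ->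
    [/\ v \in candidates i x y, candidates i x y \subset domain i,
        marked i x y \subset kernel_set
      & v \notin kernel_set -> v \notin marked i x y].
  move=> sub vc; have sub' : marked i x y \subset kernel_set.
    by apply: subset_trans sub _; exact: bigcup_sup.
  split=> //; first by apply/subsetP=> u; rewrite inE => /and3P[].
  by apply: contra; exact/subsetP.
have vd := rd _ vr.
have [m1 m2 m3] : [/\ marked i (src i) (tgt i) \subset pair_set i,
    marked i (src i) (src i) \subset pair_set i
  & marked i (tgt i) (tgt i) \subset pair_set i].
  by split; apply/subsetP=> u um; rewrite /pair_set !in_setU um ?orbT.
case: r sr {rd} vr => [|u [|w []]] //=; rewrite !inE.
  move=> /and3P[st su tu] /eqP vu; rewrite -vu in su tu *; rewrite eqxx.
  exists (candidates i (src i) (tgt i)).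
    by apply: K => //; rewrite inE su tu.
  by move=> v'; rewrite inE st => /and3P[-> -> _].
case/and5P=> st sS tS su /andP[tw uw] /orP[] /eqP ev.
- rewrite -ev in su uw *; rewrite eqxx [w == v]eq_sym (negPf uw).
  exists (candidates i (src i) (src i)).
    by apply: K => //; rewrite inE su.
  move=> v'; rewrite inE st sS tS tw => /and3P[-> _ _].
  by rewrite !inE negb_or => /andP[].
- rewrite -ev in tw uw *; rewrite eqxx (negPf uw).
  exists (candidates i (tgt i) (tgt i)).
    by apply: K => //; rewrite inE tw.
  move=> v'; rewrite inE st sS tS su => /and3P[-> _ _].
  by rewrite !inE negb_or eq_sym => /andP[].
Qed.

Definition outside (q : J -> seq V) : nat :=
  \sum_i count [predC kernel_set] (q i).

(** If an internal vertex [v] is not kept, then [4 * npairs I] candidates for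
    its part are.  The solution occupies at most that many vertices, and one of
    them, [v] itself, is not among these candidates; so some kept candidate is
    free and can replace [v]. *)
Lemma exchange b (q : J -> seq V) : inner_solution b q -> 0 < outside q ->
  exists2 q', inner_solution b q' & outside q' < outside q.
Proof.
move=> [sq dq tq xq bq]; rewrite lt0n sum_nat_eq0 negb_forall => /existsP[i].
rewrite implyTb -lt0n -has_count => /hasP[v vq /= vK].
have [_ _ qd] := dq i.
have [A [vA Ad MK /(_ vK) vM] swapA] := short_swap (sq i) qd vq.
set M := first_elements _ A in MK vM.
(* Two ends and at most two internal vertices for each pair. *)
pose used := \bigcup_j ([set src j; tgt j] :|: [set z in q j]).
have used_le : #|used| <= 4 * npairs I.
  rewrite mulnC -[X in X * _](card_ord (npairs I)); apply: card_bigcup_le => j.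
  apply: (@card_setU_le _ _ _ 2 2); first by rewrite cards2; case: eqP.
  by rewrite cardsE (leq_trans (card_size (q j)) (short_size (sq j))).
have v_used : v \in used by apply/bigcupP; exists i; rewrite // !inE vq orbT.
have [v' v'M v'_used] : exists2 v', v' \in M & v' \notin used.
  apply/subsetPn; apply: contraL used_le => sub; rewrite -ltnNge.
  apply: leq_ltn_trans (card_first_elements_ge vA vM) _; rewrite -/M.
  by apply/proper_card/properP; split=> //; exists v.
have v'A : v' \in A by move: v'M; rewrite inE => /andP[].
have [v'T v'q] : v' \notin terminals /\ forall j, v' \notin q j.
  split=> [|j]; apply: contra v'_used.
    by case/bigcupP=> j _ vj; apply/bigcupP; exists j; rewrite // inE vj.
  by move=> vj; apply/bigcupP; exists j; rewrite // !inE vj orbT.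
pose q' j := if j == i then swap v v' (q i) else q j.
have mem_q' j z : z \in q' j -> z \in q j \/ j = i /\ z = v'.
  rewrite /q'; case: eqP => [->|_]; last by left.
  by case/mem_swap=> [->|zq]; [right | left].
have nil_q' j : q' j = [::] -> q j = [::].
  by rewrite /q'; case: eqP => // ->; case: (q i).
exists q'; first split.
- move=> j; rewrite /q'; case: eqP => [->|_]; last exact: sq.
  exact: swapA.
- move=> j; have [sd td qjd] := dq j; split=> // z /mem_q'[/qjd//|[-> ->]].
  exact: (subsetP Ad).
- by move=> j z /mem_q'[/tq|[_ ->]].
- move=> j l jl z /mem_q'[zq|[ji zv]]; apply/negP=> /mem_q'[zl|[li zv']].
  + by have := xq _ _ jl _ zq; rewrite zl.
  + by have := v'q j; rewrite -zv' zq.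
  + by have := v'q l; rewrite -zv zl.
  + by rewrite ji li eqxx in jl.
- by move=> bT j l jl /nil_q' + /nil_q'; exact: bq.
rewrite /outside [X in X < _](bigD1 i) // [X in _ < X](bigD1 i) //=.
rewrite {1}/q' eqxx -addSn leq_add //; last first.
  by apply/eq_leq/eq_bigr=> j /negPf ji; rewrite /q' ji.
rewrite -[X in _ < X](@count_swap _ v v') //=; last first.
  by rewrite negbK; exact: (subsetP MK).
by rewrite -[X in X < _]addn0 ltn_add2l -has_count has_pred1.
Qed.

Lemma inner_solution_kernel b (q : J -> seq V) : inner_solution b q ->
  exists2 q', inner_solution b q' & forall i, {subset q' i <= kernel_set}.
Proof.
move: {2}(outside q) (leqnn (outside q)) => m.
elim: m q => [|m IH] q le_m sol.
  exists q => // i v vq; move: le_m; rewrite leqn0 sum_nat_eq0 => /forallP/(_ i).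
  rewrite implyTb; apply: contraTT => vK; rewrite -lt0n -has_count.
  by apply/hasP; exists v.
case: (posnP (outside q)) => [q0|q_gt0]; first by apply: (IH q) => //; rewrite q0.
have [q' sol' lt_q] := exchange sol q_gt0.
by apply: IH sol'; rewrite -ltnS; apply: leq_trans lt_q _.
Qed.

Lemma solution_kernel b P : solution b P ->
  exists2 P', solution b P' & forall i, {subset P' i <= kernel_set}.
Proof.
case/solution_inner=> q0 /inner_solution_kernel[q sol qK].
exists (fun i => route (src i) (tgt i) (q i)); first exact: inner_solution_route.
move=> i v; case: sol => sq _ _ _ _; rewrite mem_route //.
by case/or3P=> [/eqP->|/eqP->|/qK//]; apply: terminals_kernel;
  rewrite ?src_terminal ?tgt_terminal.
Qed.

End Split.
End Solutions.

(** * The kernel as an induced instance *)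

Section Induced.
Variable I : instance.
Notation V := (vertex (igraph I)).
Variable K : {set V}.
Hypothesis terminals_K : {subset terminals I <= K}.

Let f : 'I_#|K| -> V := enum_val.

Lemma induced_sym : symmetric (fun a b => adj (f a) (f b)).
Proof. by move=> a b; exact: adj_sym. Qed.

Lemma induced_irr : irreflexive (fun a b => adj (f a) (f b)).
Proof. by move=> a; exact: adj_irr. Qed.

Definition induced_graph : sgraph := SGraph induced_sym induced_irr.

Definition induced : instance :=
  @Instance induced_graph (npairs I)
    (fun i => enum_rank_in (terminals_K (src_terminal i)) (src i))
    (fun i => enum_rank_in (terminals_K (tgt_terminal i)) (tgt i))
    (fun i => [set a : 'I_#|K| | f a \in domain i]).

Lemma f_inj : injective f. Proof. exact: enum_val_inj. Qed.

Lemma f_src (i : 'I_(npairs I)) : f (@src induced i) = src i.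
Proof. by rewrite /f enum_rankK_in // terminals_K // src_terminal. Qed.

Lemma f_tgt (i : 'I_(npairs I)) : f (@tgt induced i) = tgt i.
Proof. by rewrite /f enum_rankK_in // terminals_K // tgt_terminal. Qed.

Lemma induced_split : split_graph (igraph I) -> split_graph induced_graph.
Proof.
move=> [C [S [CS CS0 Cc Si]]].
exists (f @^-1: C), (f @^-1: S); split.
- by rewrite -preimsetU CS preimsetT.
- by rewrite -preimsetI CS0 preimset0.
- move=> a b; rewrite !inE => aC bC ab; apply: Cc => //.
  by rewrite (inj_eq f_inj).
- by move=> a b; rewrite !inE => aS bS; exact: Si.
Qed.

Lemma solution_map b (P : 'I_(npairs I) -> seq V)
    (P' : 'I_(npairs I) -> seq 'I_#|K|) :
  (forall i, P i = map f (P' i)) -> @solution induced b P' <-> @solution I b P.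
Proof.
move=> PP'.
have memP i a : (f a \in P i) = (a \in P' i) by rewrite PP' (mem_map f_inj).
have st i : st_path (src i) (tgt i) (P i) =
    @st_path induced_graph (@src induced i) (@tgt induced i) (P' i).
  rewrite PP' -f_src -f_tgt; case: (P' i) => //= a r.
  rewrite (inj_eq f_inj) last_map (inj_eq f_inj) path_map.
  by rewrite (mem_map f_inj) (map_inj_uniq f_inj).
have inP i v : v \in P i -> exists2 a, v = f a & a \in P' i.
  by rewrite PP' => /mapP[a]; exists a.
split=> -[rP dP xP]; split.
- move=> i; have [p sub] := rP i; split; first by rewrite st.
  by move=> v /inP[a -> /sub]; rewrite inE.
- move=> i j ij v /inP[a -> aP]; rewrite -f_src -f_tgt !(inj_eq f_inj) memP.
  exact: dP.
- move=> bT i j ij e; apply: (xP bT i j ij) => a.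
  by rewrite -!memP e.
- move=> i; have [p sub] := rP i; split; first by rewrite -st.
  by move=> a; rewrite -memP inE; exact: sub.
- move=> i j ij a; rewrite -!memP -!(inj_eq f_inj) f_src f_tgt.
  exact: dP.
- move=> bT i j ij e; apply: (xP bT i j ij) => v.
  by apply/idP/idP=> /inP[a ->]; rewrite memP ?e -?e -?memP.
Qed.

(** Solutions of the induced instance are exactly the solutions that stay
    inside [K], so the two instances are equivalent as soon as solutions can be
    moved into [K]. *)
Lemma problem_induced b :
    (forall P, @solution I b P ->
       exists2 P', @solution I b P' & forall i, {subset P' i <= K}) ->
  problem I b <-> problem induced b.
Proof.
move=> toK; rewrite !problemE; split=> [[P /toK[Q sQ QK]] | [P' sP']]; last first.
  by exists (fun i => map f (P' i)); rewrite -(@solution_map _ _ P').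
have H i : exists r : seq 'I_#|K|, Q i = map f r.
  elim: (Q i) (QK i) => [|v r IH] sub; first by exists [::].
  have [|r' ->] := IH; first by move=> u ur; rewrite sub // inE ur orbT.
  have vK : v \in K by rewrite sub ?mem_head.
  by exists (enum_rank_in vK v :: r'); rewrite /= /f enum_rankK_in.
have [P' PP'] := fin_all_exists H.
by exists P'; apply/(solution_map b PP').
Qed.

(** The new name of a vertex is computable without listing [K]: it is the number
    of smaller vertices of [K], because [enum K] is increasing. *)
Lemma card_below_enum_val (a : 'I_#|K|) : #|below K (f a)| = a.
Proof.
pose s := map val (enum K).
have sz_s : size s = #|K| by rewrite size_map -cardE.
have s_sorted : sorted ltn s.
  rewrite /s sorted_map /enum_mem -enumT; apply: sorted_filter.
    by move=> x y z /=; exact: ltn_trans.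
  by rewrite -(@sorted_map _ _ val ltn) val_enum_ord iota_ltn_sorted.
have fa : val (f a) = nth 0 s a.
  by rewrite (nth_map (f a)) -?cardE // /f -enum_val_nth.
transitivity (count (fun x => x < nth 0 s a) s); last first.
  by apply: (@count_lt_nth _ nat 0 s a); rewrite ?sz_s.
rewrite -fa count_map -size_filter cardE /below /enum_mem.
by rewrite -filter_predI; congr size; apply: eq_filter => u; rewrite !inE andbC.
Qed.

End Induced.

(** * Programs that run within a time bound *)

Definition runs (c : cmd) (st : state) (T : nat) (Q : state -> Prop) : Prop :=
  exists m st', [/\ exec c st m st', m <= T & Q st'].

Lemma runs_weaken c st T T' (Q Q' : state -> Prop) :
  runs c st T Q -> T <= T' -> (forall st', Q st' -> Q' st') -> runs c st T' Q'.
Proof.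
move=> [m [st' [ex le_m HQ]]] le_T QQ'.
by exists m, st'; split; [| exact: leq_trans le_T | exact: QQ'].
Qed.

Lemma runs_assign st a e1 e2 (Q : state -> Prop) :
  Q (update st a (eval st e1) (eval st e2)) -> runs (Assign a e1 e2) st 1 Q.
Proof. by move=> HQ; do 2!eexists; split; [exact: ExecAssign | |]. Qed.

Lemma runs_seq c1 c2 st T1 T2 (R Q : state -> Prop) :
  runs c1 st T1 R -> (forall st1, R st1 -> runs c2 st1 T2 Q) ->
  runs (Seq c1 c2) st (T1 + T2) Q.
Proof.
move=> [m1 [st1 [ex1 le1 HR]]] /(_ _ HR) [m2 [st2 [ex2 le2 HQ]]].
exists (m1 + m2), st2; split=> //; last exact: leq_add.
exact: ExecSeq ex1 ex2.
Qed.

Lemma runs_assign_seq st a e1 e2 c T (Q : state -> Prop) :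
  runs c (update st a (eval st e1) (eval st e2)) T Q ->
  runs (Seq (Assign a e1 e2) c) st T.+1 Q.
Proof.
move=> H; apply: (@runs_seq _ _ _ 1 T (fun st1 => runs c st1 T Q)) => //.
exact: runs_assign.
Qed.

(** Total correctness of counting loops: [Inv i] holds after [i] rounds. *)
Lemma runs_while e c T n (Inv : nat -> state -> Prop) st :
    (forall i st1, i < n -> Inv i st1 ->
       eval st1 e != 0 /\ runs c st1 T (Inv i.+1)) ->
    (forall st1, Inv n st1 -> eval st1 e = 0) ->
  Inv 0 st -> runs (While e c) st (n * T.+1).+1 (Inv n).
Proof.
move=> step stop H0.
suff: forall m st1, m <= n -> Inv (n - m) st1 ->
    runs (While e c) st1 (m * T.+1).+1 (Inv n).
  by move=> /(_ n st (leqnn n)); rewrite subnn; apply.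
elim=> [|m IHm] st1 le_mn HI.
  rewrite subn0 in HI; exists 1, st1; split=> //.
  by apply: ExecWhileFalse; exact: stop HI.
have lt_i : n - m.+1 < n by lia.
have [ne0 [m1 [st2 [ex1 le1 HI1]]]] := step _ _ lt_i HI.
rewrite subnSK // in HI1.
have [m2 [st3 [ex2 le2 HI2]]] := IHm st2 (ltnW le_mn) HI1.
exists (m1 + m2).+1, st3; split=> //; first exact: ExecWhileTrue ex1 ex2.
by rewrite mulSn; lia.
Qed.

(** * A language of polynomial-time arithmetic *)

(** Input cells, arithmetic and bounded sums.  Values stay polynomial in the
    input because the range of a sum is itself the value of a term; hence so do
    running times.  Everything the kernelization computes is such a term. *)
Inductive term :=
  | TConst of nat
  | TVar of nat
  | TIn of term
  | TAdd of term & term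
  | TSub of term & term
  | TMul of term & term
  | TSum of nat & term & term.

Definition upd (rho : nat -> nat) (x i : nat) : nat -> nat :=
  fun y => if y == x then i else rho y.

Fixpoint value (w rho : nat -> nat) (t : term) : nat :=
  match t with
  | TConst c => c
  | TVar x => rho x
  | TIn t1 => w (value w rho t1)
  | TAdd t1 t2 => value w rho t1 + value w rho t2
  | TSub t1 t2 => value w rho t1 - value w rho t2
  | TMul t1 t2 => value w rho t1 * value w rho t2
  | TSum x t1 t2 => \sum_(i < value w rho t1) value w (upd rho x i) t2
  end.

Lemma eq_value t w w' rho rho' :
  w =1 w' -> rho =1 rho' -> value w rho t = value w' rho' t.
Proof.
move=> eqw; elim: t rho rho' => //=
  [t IH | t IH u IHu | t IH u IHu | t IH u IHu | x t IH u IHu] rho rho' eqr;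
  rewrite ?(IH _ _ eqr) ?(IHu _ _ eqr) ?eqw //.
by apply: eq_bigr => i _; apply: IHu => y; rewrite /upd; case: ifP.
Qed.

(** Array 2 holds temporaries, used as a stack, and array 3 the variables. *)
Definition reg r := Cell 2 (Const r).
Definition set_reg r e := Assign 2 (Const r) e.
Definition var x := Cell 3 (Const x).
Definition set_var x e := Assign 3 (Const x) e.

(** [compile t r] leaves the value of [t] in register [r] and disturbs no
    register below [r].  The loop of a sum counts in the variable it binds, whose
    previous value is saved in a register and restored at the end, so that names
    may be rebound freely. *)
Fixpoint compile (t : term) (r : nat) : cmd :=
  match t with
  | TConst c => set_reg r (Const c)
  | TVar x => set_reg r (var x)
  | TIn t1 => Seq (compile t1 r) (set_reg r (Cell 0 (reg r)))
  | TAdd t1 t2 =>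
      Seq (compile t1 r) (Seq (compile t2 r.+1)
        (set_reg r (Add (reg r) (reg r.+1))))
  | TSub t1 t2 =>
      Seq (compile t1 r) (Seq (compile t2 r.+1)
        (set_reg r (Defs.Sub (reg r) (reg r.+1))))
  | TMul t1 t2 =>
      Seq (compile t1 r) (Seq (compile t2 r.+1) (Seq (set_reg r.+2 (Const 0))
        (Seq (While (reg r)
               (Seq (set_reg r.+2 (Add (reg r.+2) (reg r.+1)))
                    (set_reg r (Defs.Sub (reg r) (Const 1)))))
             (set_reg r (reg r.+2)))))
  | TSum x t1 t2 =>
      Seq (compile t1 r) (Seq (set_reg r.+1 (Const 0))
        (Seq (set_reg r.+2 (var x)) (Seq (set_var x (Const 0))
          (Seq (While (Defs.Sub (reg r) (var x))
                 (Seq (compile t2 r.+3)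
                 (Seq (set_reg r.+1 (Add (reg r.+1) (reg r.+3)))
                      (set_var x (Add (var x) (Const 1))))))
          (Seq (set_var x (reg r.+2)) (set_reg r (reg r.+1)))))))
  end.

Definition frame (r : nat) (st st' : state) : Prop :=
  forall a i, (a != 2) || (i < r) -> st' a i = st a i.

Definition bounded (N : nat) (st : state) : Prop :=
  forall i, st 0 i <= N /\ st 3 i <= N.

Lemma frame_bounded r st st' N : frame r st st' -> bounded N st -> bounded N st'.
Proof. by move=> fr b i; rewrite !fr. Qed.

Lemma frame_value r st st' t :
  frame r st st' -> value (st' 0) (st' 3) t = value (st 0) (st 3) t.
Proof. by move=> fr; apply: eq_value => i; rewrite fr. Qed.

(** The bound on the value is part of the induction: it bounds the number of
    rounds of the loops for products and sums. *)
Definition poly_runs (c : cmd) (t : term) (r d : nat) : Prop :=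
  forall st N, 1 < N -> bounded N st ->
    value (st 0) (st 3) t <= N ^ d /\
    runs c st (N ^ d) (fun st' => frame r st st' /\
                                  st' 2 r = value (st 0) (st 3) t).

Section Pow.
Variables (N : nat) (N_gt1 : 1 < N).
Lemma pow_const c : c <= N ^ c.
Proof. exact: ltnW (ltn_expl _ _). Qed.
Lemma pow_add a b d e : a <= N ^ d -> b <= N ^ e -> a + b <= N ^ (d + e).+1.
Proof.
have pow_gt0 k : 0 < N ^ k by rewrite expn_gt0 ltnW.
move=> Ha Hb; rewrite expnS expnD.
apply: leq_trans (leq_add Ha Hb) (leq_trans _ (leq_mul N_gt1 (leqnn _))).
by have := pow_gt0 d; have := pow_gt0 e; nia.
Qed.
Lemma pow_mul a b d e : a <= N ^ d -> b <= N ^ e -> a * b <= N ^ (d + e).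
Proof. by move=> Ha Hb; rewrite expnD leq_mul. Qed.
Lemma pow_weaken a d e : a <= N ^ d -> d <= e -> a <= N ^ e.
Proof. by move=> Ha de; apply: leq_trans Ha _; rewrite leq_pexp2l //; lia. Qed.
End Pow.

Lemma runs_prefix c1 c2 t r d st N T (Q : state -> Prop) :
    poly_runs c1 t r d -> 1 < N -> bounded N st ->
    (forall st1, frame r st st1 -> st1 2 r = value (st 0) (st 3) t ->
       runs c2 st1 T Q) ->
  runs (Seq c1 c2) st (N ^ d + T) Q.
Proof.
move=> H N1 b H2; have [_ R] := H st N N1 b.
by apply: (runs_seq R) => st1 [f1 v1]; exact: H2.
Qed.


Ltac split_update :=
  rewrite /update /=; repeat (case: ifP => [?|?]; try lia); try done.

Lemma frame_trans r r' st st1 st2 :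
  frame r st st1 -> r <= r' -> frame r' st1 st2 -> frame r st st2.
Proof. by move=> f1 le f2 a i H; rewrite f2 ?f1 //; lia. Qed.

Lemma frame_update r r' x st st1 :
  frame r st st1 -> r <= r' -> frame r st (update st1 2 r' x).
Proof. by move=> f1 le a i H; rewrite -f1 //; split_update. Qed.

Lemma compile_binop (o : nat -> nat -> nat) eo t u T d e f r :
    (forall st e1 e2, eval st (eo e1 e2) = o (eval st e1) (eval st e2)) ->
    (forall w rho, value w rho T = o (value w rho t) (value w rho u)) ->
    (forall a b N, 1 < N -> a <= N ^ d -> b <= N ^ e -> o a b <= N ^ f) ->
    (forall r, poly_runs (compile t r) t r d) ->
    (forall r, poly_runs (compile u r) u r e) ->
  poly_runs (Seq (compile t r) (Seq (compile u r.+1)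
     (set_reg r (eo (reg r) (reg r.+1))))) T r (f + (d + e).+2).
Proof.
move=> Ho HT Hf IH IHu st N N1 b.
have [vt _] := IH r _ _ N1 b; have [vu _] := IHu r _ _ N1 b.
split; first by rewrite HT; apply: pow_weaken (Hf _ _ _ N1 vt vu) _ => //; lia.
apply: runs_weaken (runs_prefix (IH r) N1 b _) _ (fun _ => id).
  move=> st1 f1 v1; apply: runs_prefix (IHu r.+1) N1 (frame_bounded f1 b) _.
  move=> st2 f2 v2; apply: runs_assign.
  rewrite Ho /= v2 f2 ?ltnS ?leqnn ?orbT // v1 (frame_value _ f1) -HT.
  split; last by split_update.
  exact: frame_update (frame_trans f1 (leqnSn r) f2) _.
apply: leq_trans (_ : N ^ (d + e.+1).+1 <= _).
  by apply: pow_add => //; rewrite expnS; have := expn_gt0 N e; nia.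
by rewrite leq_pexp2l //; lia.
Qed.


(** The 10 is a generous allowance for the bookkeeping instructions. *)
Lemma compile_mul t u d e r :
    (forall r, poly_runs (compile t r) t r d) ->
    (forall r, poly_runs (compile u r) u r e) ->
  poly_runs (compile (TMul t u) r) (TMul t u) r (d + (e + d + 10)).
Proof.
move=> IH IHu st N N1 b.
have [vt _] := IH r _ _ N1 b; have [vu _] := IHu r _ _ N1 b.
rewrite /=; set m := value _ _ t in vt *; set n := value _ _ u in vu *.
split; first by apply: pow_weaken (pow_mul vt vu) _ => //; lia.
apply: runs_weaken (runs_prefix (IH r) N1 b _) _ (fun _ => id).
  move=> st1 f1 v1; apply: runs_prefix (IHu r.+1) N1 (frame_bounded f1 b) _.
  move=> st2 f2 v2; apply: runs_assign_seq => /=.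
  rewrite (frame_value _ f1) -/n in v2; rewrite -/m in v1.
  have v1' : st2 2 r = m by rewrite f2 // ltnSn orbT.
  have f12 := frame_trans f1 (leqnSn r) f2.
  pose Inv i st3 := [/\ frame r st st3, st3 2 r = m - i, st3 2 r.+1 = n
                     & st3 2 r.+2 = i * n].
  apply: (@runs_seq _ _ _ _ 1 (Inv m)) => [|st3 [f3 _ _ v3]]; last first.
    by apply: runs_assign; split; [exact: frame_update | rewrite -v3; split_update].
  apply: (@runs_while _ _ 2) => [i st3 lt_i [f3 w1 w2 w3] | st3 [_ + _ _] | ].
  - split; first by rewrite /= w1; lia.
    apply: runs_assign_seq; apply: runs_assign; split.
    + rewrite /=; apply: frame_update => //.
      by apply: frame_update => //; lia.
    + by split_update.
    + by split_update.
    + by rewrite mulSn /= w2 w3; split_update.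
  - by rewrite /= subnn.
  - split; [ | | |by split_update].
    + by apply: frame_update => // /=; lia.
    + by rewrite subn0; split_update.
    + by split_update.
have -> : N ^ d + (N ^ e + ((m * 3).+1 + 1).+1) = N ^ d + (N ^ e + (m * 3 + 3)).
  by lia.
apply: leq_trans (_ : N ^ (d + (e + ((d + 3) + 3).+1).+1).+1 <= _).
  do 3!(apply: pow_add => //).
    by apply: pow_mul vt _; exact: pow_const.
  exact: pow_const.
by rewrite leq_pexp2l //; lia.
Qed.

(** The body of the sum runs with its variable up to the value of [t], so its
    time bound is taken at [X], a bound on both that value and [N]; this is where
    exponents multiply.  The 30 covers the bookkeeping instructions. *)
Lemma compile_sum x t u d e r :
    (forall r, poly_runs (compile t r) t r d) ->
    (forall r, poly_runs (compile u r) u r e) ->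
  poly_runs (compile (TSum x t u) r) (TSum x t u) r (d + (d + d.+1 * e + 30)).
Proof.
move=> IH IHu st N N1 b; have [vt _] := IH r _ _ N1 b.
set X := N ^ d.+1; rewrite /=; set n := value _ _ t in vt *.
have le_X : n <= X by apply: pow_weaken vt _.
have N_X : N <= X by rewrite -{1}[N]expn1 leq_pexp2l // ltnW.
have X1 : 1 < X by apply: leq_trans N_X.
have bX : bounded X st by move=> i; case: (b i); lia.
pose F i := value (st 0) (upd (st 3) x i) u.
have F_X i : i < n -> F i <= X ^ e.
  move=> lt_i; have b' : bounded X (update st 3 x i).
    by move=> j; case: (bX j); split_update.
  have [+ _] := IHu r _ _ X1 b'.
  by congr (_ <= _); apply: eq_value => j; split_update; rewrite /upd; split_update.
split.
  apply: leq_trans (_ : \sum_(i < n) X ^ e <= _).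
    by apply: leq_sum => i _; apply: F_X.
  rewrite sum_nat_const card_ord /X -expnM.
  apply: leq_trans (leq_mul vt (leqnn _)) _.
  by rewrite -expnD leq_pexp2l //; lia.
apply: runs_weaken (runs_prefix (IH r) N1 b _) _ (fun _ => id).
  move=> st1 f1 v1; do 3!apply: runs_assign_seq.
  pose Inv i st2 := [/\ forall a j, (a != 2) || (j < r) -> (a != 3) || (j != x) ->
                        st2 a j = st a j, st2 2 r = n,
                        st2 2 r.+1 = \sum_(j < i) F j, st2 2 r.+2 = st 3 x
                      & st2 3 x = i].
  apply: (@runs_seq _ _ _ _ 2 (Inv n)) => [|st2 [f2 _ v2 v3 _]]; last first.
    apply: runs_assign_seq; apply: runs_assign; split; last first.
      by rewrite -v2; split_update.
    apply: frame_update => // a j H; rewrite /update /=.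
    case: ifP => [/andP[/eqP-> /eqP->] //|].
    by move=> ax; rewrite f2 //; lia.
  apply: (@runs_while _ _ (X ^ e + 2)) =>
    [i st2 lt_i [f2 w1 w2 w3 w4] | st2 [_ w1 _ _ w2] | ].
  - split; first by rewrite /= w1 w4; lia.
    have b2 : bounded X st2.
      move=> j; rewrite f2 //; have [-> Hj] := bX j; split=> //.
      by case: (eqVneq j x) => [->|jx]; [rewrite w4; lia | rewrite f2 // jx orbT].
    apply: (runs_prefix (IHu r.+3) X1 b2) => st3 f3 v3.
    have {v3} : st3 2 r.+3 = F i.
      rewrite v3; apply: eq_value => j; first by rewrite f2.
      by rewrite /upd; case: ifP => [/eqP->//|jx]; rewrite f2 // jx orbT.
    move=> v3; apply: runs_assign_seq; apply: runs_assign; split.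
    + move=> a j H H'; rewrite -f2 // -f3; last by lia.
      by split_update.
    + by rewrite -w1 -(f3 2 r); [split_update | lia].
    + rewrite big_ord_recr /= -v3 -w2 -(f3 2 r.+1); last by lia.
      by split_update.
    + by rewrite -w3 -(f3 2 r.+2); [split_update | lia].
    + by rewrite -w4 -(f3 3 x) //; split_update.
  - by rewrite /= w1 w2 subnn.
  - split.
    + by move=> a j H H'; rewrite -f1 //; split_update.
    + by rewrite -[n]v1; split_update.
    + by rewrite big_ord0; split_update.
    + by rewrite /= -f1 //; split_update.
    + by split_update.
rewrite /X -expnM.
have -> : N ^ d + ((n * (N ^ (d.+1 * e) + 2).+1).+1 + 2).+3
   = N ^ d + (n * (N ^ (d.+1 * e) + 3) + 6) by lia.
apply: leq_trans (_ : N ^ (d + ((d + (d.+1 * e + 3).+1) + 6).+1).+1 <= _).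
  do 2!(apply: pow_add => //); last exact: pow_const.
  apply: pow_mul vt _; apply: pow_add => //; exact: pow_const.
by rewrite leq_pexp2l //; lia.
Qed.

Lemma compile_correct t : exists d, forall r, poly_runs (compile t r) t r d.
Proof.
elim: t => [c | x | t [d IH] | t [d IH] u [e IHu] | t [d IH] u [e IHu]
  | t [d IH] u [e IHu] | x t [d IH] u [e IHu]].
- exists c => r st N N1 b /=; split; first exact: pow_const.
  apply: runs_weaken (runs_assign _) _ (fun _ => id).
    by split; [move=> a i H |]; split_update.
  by rewrite expn_gt0; lia.
- exists 1 => r st N N1 b /=; rewrite expn1; split; first by case: (b x).
  apply: runs_weaken (runs_assign _) _ (fun _ => id); last by lia.
  by split; [move=> a i H |]; split_update.
- exists d.+2 => r st N N1 b; have [vt R] := IH r st N N1 b; split.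
    have [bv _] := b (value (st 0) (st 3) t).
    by apply: (@pow_weaken N N1 _ 1); rewrite ?expn1.
  apply: runs_weaken (runs_prefix (IH r) N1 b _) _ (fun _ => id).
    move=> st1 f1 v1; apply: runs_assign.
    rewrite /= v1 f1 //; split; last by split_update.
    exact: frame_update.
  apply: leq_trans (pow_add N1 (leqnn _) (pow_const N1 1)) _.
  by rewrite leq_pexp2l //; lia.
- by exists ((d + e).+1 + (d + e).+2) => r;
    apply: (@compile_binop addn Add) => // a b N N1; apply: pow_add.
- exists (d + (d + e).+2) => r.
  apply: (@compile_binop subn Defs.Sub) => // a b N N1 Ha Hb.
  by apply: leq_trans Ha; apply: leq_subr.
- by eexists=> r; apply: compile_mul IH IHu.
- by eexists=> r; apply: compile_sum IH IHu.
Qed.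

(** * Programs that tabulate a term *)

Definition table_program (len cell : term) : cmd :=
  Seq (compile len 0)
    (While (Defs.Sub (reg 0) (var 0))
       (Seq (compile cell 1)
       (Seq (Assign 1 (var 0) (reg 1))
            (set_var 0 (Add (var 0) (Const 1)))))).

Lemma table_program_correct len cell : exists c d, forall w : seq nat,
    0 < size w -> (forall i, nth 0 w i <= size w) ->
  exists m st,
    [/\ exec (table_program len cell) (initial w) m st,
        m <= c * size w ^ d + c
      & forall j, j < value (nth 0 w) (fun _ => 0) len ->
          st 1 j = value (nth 0 w) (upd (fun _ => 0) 0 j) cell].
Proof.
have [d IH] := compile_correct len; have [e IHu] := compile_correct cell.
pose D := d + (d + d.+1 * e + 20).
(* The bound is [(size w).+2 ^ D], and [(size w).+2 <= 3 * size w]. *)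
exists (3 ^ D), D => w w_gt0 w_le.
pose N := (size w).+2; have N1 : 1 < N by [].
have b : bounded N (initial w).
  by move=> i; split=> //=; apply: leq_trans (w_le i) _; rewrite /N; lia.
have [vt _] := IH 0 _ _ N1 b.
set n := value _ _ len in vt *; set X := N ^ d.+1.
have le_X : n <= X by apply: pow_weaken vt _.
have N_X : N <= X by rewrite -{1}[N]expn1 leq_pexp2l.
have X1 : 1 < X by apply: leq_trans N_X.
pose F i := value (nth 0 w) (upd (fun _ => 0) 0 i) cell.
pose Inv i st := [/\ st 0 =1 nth 0 w, st 3 =1 upd (fun _ => 0) 0 i, st 2 0 = n
                  & forall j, j < i -> st 1 j = F j].
suff [m [st [ex le_m [_ _ _ out]]]] :
    runs (table_program len cell) (initial w) (N ^ D) (Inv n).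
  exists m, st; split=> //; apply: leq_trans le_m (leq_trans _ (leq_addr _ _)).
  by rewrite -expnMn leq_exp2r; rewrite /N /D; lia.
apply: runs_weaken (runs_prefix (IH 0) N1 b _) _ (fun _ => id).
  move=> st1 f1 v1.
  apply: (@runs_while _ _ (X ^ e + 2)) =>
    [i st2 lt_i [f2 w1 w2 w3] | st2 [_ w1 w2 _] | ].
  - split; first by rewrite /= w1 w2 /upd /=; lia.
    have b2 : bounded X st2.
      move=> j; rewrite f2 w1; split; first by apply: leq_trans (w_le j) _; lia.
      by rewrite /upd; case: ifP => // _; lia.
    apply: (runs_prefix (IHu 1) X1 b2) => st3 f3; rewrite (eq_value _ f2 w1) => v3.
    have f3' a j : a != 2 -> st3 a j = st2 a j by move=> a2; rewrite f3 // a2.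
    apply: runs_assign_seq; apply: runs_assign; split.
    + by move=> j; rewrite -f2 -f3'.
    + move=> j; rewrite /upd /update /= !f3' // !w1 /upd /=.
      by case: eqP => [_|//]; rewrite addn1.
    + by rewrite -w2 -(f3 2 0).
    + move=> j; rewrite ltnS leq_eqVlt /update /= (f3' 3) // (f3' 1) // w1 /upd /=.
      by case: eqP => [-> _ | _ /= lt_j]; rewrite ?v3 ?w3.
  - by rewrite /= w1 w2 subnn.
  - split=> [j | j | // | //]; rewrite f1 //=.
    by rewrite /upd; case: (j == 0).
rewrite /X -expnM.
have -> : N ^ d + (n * (N ^ (d.+1 * e) + 2).+1).+1
   = N ^ d + (n * (N ^ (d.+1 * e) + 3) + 1) by lia.
apply: leq_trans (_ : N ^ (d + ((d + (d.+1 * e + 3).+1) + 1).+1).+1 <= _).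
  do 2!(apply: pow_add => //).
  by apply: pow_mul vt _; apply: pow_add => //; exact: pow_const.
by rewrite leq_pexp2l //; lia.
Qed.

(** * Cells of encoded instances *)

(** The contribution to cell [j] of a block [s] that starts at position [o].  It
    is 0 outside the block, so the cells of a concatenation are sums. *)
Definition cell_from (o : nat) (s : seq nat) (j : nat) : nat :=
  (o <= j) * nth 0 s (j - o).

Lemma cell_from0 s j : cell_from 0 s j = nth 0 s j.
Proof. by rewrite /cell_from subn0 mul1n. Qed.

Lemma cell_from_cat o s1 s2 j :
  cell_from o (s1 ++ s2) j = cell_from o s1 j + cell_from (o + size s1) s2 j.
Proof.
rewrite /cell_from nth_cat; case: (leqP o j) => oj.
  rewrite !mul1n; case: ltnP => lt.
    by rewrite [o + _ <= j]leqNgt (_ : j < o + size s1) /= ?addn0 //; lia.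
  rewrite [nth 0 s1 _]nth_default // (_ : o + size s1 <= j) ?mul1n; last by lia.
  by rewrite add0n; congr nth; lia.
by rewrite !mul0n leqNgt (_ : j < o + size s1) //; lia.
Qed.

(** Instead of dividing [j] by the row length, sum over all positions and select
    the one that equals [j]: sums are available in the term language, divisions
    are not. *)
Lemma cell_from_rows o m (rows : seq (seq nat)) j :
    {in rows, forall r, size r = m} ->
  cell_from o (flatten rows) j =
  \sum_(a < size rows) \sum_(b < m)
    (j == o + (a * m + b)) * nth 0 (nth [::] rows a) b.
Proof.
elim: rows o => [|r rows IH] o sz.
  by rewrite big_ord0 /cell_from nth_nil muln0.
have szr : size r = m by rewrite sz ?mem_head.
rewrite /= cell_from_cat big_ord_recl /= IH => [|r' r'in]; last first.
  by rewrite sz // inE r'in orbT.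
congr (_ + _).
  rewrite /cell_from.
  case: (boolP ((o <= j) && (j - o < m))) => [/andP[oj lt_m]|out].
    rewrite oj mul1n (bigD1 (Ordinal lt_m)) //= big1 ?addn0.
      by rewrite (_ : (j == _) = true) ?mul1n //; lia.
    move=> b nb; case: eqP => // jb; case/eqP: nb; apply: val_inj => /=.
    by rewrite jb mul0n add0n addKn.
  rewrite big1 => [|b _]; last first.
    by have lt_b := ltn_ord b; rewrite (_ : (j == _) = false) //; lia.
  by case: (leqP o j) out => //= oj; rewrite -leqNgt -szr => /(nth_default 0) ->.
apply: eq_bigr => a _; apply: eq_bigr => b _; congr ((j == _ : bool) * _).
by rewrite szr /bump /= mulSn; lia.
Qed.

Lemma nth_rows m (rows : seq (seq nat)) a b :
    {in rows, forall r, size r = m} -> b < m ->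
  nth 0 (flatten rows) (a * m + b) = nth 0 (nth [::] rows a) b.
Proof.
move=> + lt_b; elim: rows a => [|r rows IH] a sz; first by rewrite !nth_nil.
have szr : size r = m by rewrite sz ?mem_head.
case: a => [|a] /=; rewrite nth_cat szr; first by rewrite lt_b.
rewrite ltnNge mulSn -addnA leq_addr /= addKn.
by apply: IH => r' r'in; rewrite sz // inE r'in orbT.
Qed.

Definition matrix_seq p m (F : 'I_p -> 'I_m -> nat) : seq nat :=
  flatten [seq [seq F a b | b <- enum 'I_m] | a <- enum 'I_p].

Section Matrix.
Variables (p m : nat) (F : 'I_p -> 'I_m -> nat).
Let rows := [seq [seq F a b | b <- enum 'I_m] | a <- enum 'I_p].

Lemma matrix_row_size : {in rows, forall r, size r = m}.
Proof. by move=> r /mapP[a _ ->]; rewrite size_map size_enum_ord. Qed.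

Lemma nth_matrix_row (a : 'I_p) (b : 'I_m) : nth 0 (nth [::] rows a) b = F a b.
Proof.
rewrite (nth_map a) ?size_enum_ord // (nth_map b) ?size_enum_ord //.
by rewrite !nth_ord_enum.
Qed.

Lemma size_matrix : size (flatten rows) = p * m.
Proof. by rewrite size_allpairs !size_enum_ord. Qed.

Lemma nth_matrix (a : 'I_p) (b : 'I_m) : nth 0 (flatten rows) (a * m + b) = F a b.
Proof. by rewrite (nth_rows _ matrix_row_size) // nth_matrix_row. Qed.

Lemma cell_from_matrix o j : cell_from o (flatten rows) j =
  \sum_(a < p) \sum_(b < m) (j == o + (a * m + b)) * F a b.
Proof.
rewrite (cell_from_rows _ _ matrix_row_size) size_map size_enum_ord.
by apply: eq_bigr => a _; apply: eq_bigr => b _; rewrite nth_matrix_row.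
Qed.
End Matrix.

Section EncodingCells.
Variable I : instance.
Notation n := (nverts (igraph I)).
Notation k := (npairs I).

Definition adj_matrix : 'I_n -> 'I_n -> nat := fun u v => adj u v.
(** The list of pairs is a matrix with two columns, so that all three blocks of
    an encoding are treated alike. *)
Definition pair_matrix : 'I_k -> 'I_2 -> nat :=
  fun i b => if val b == 0 then src i else tgt i.
Definition domain_matrix : 'I_k -> 'I_n -> nat := fun i v => v \in domain i.

Lemma encodeE : encode I = [:: n; k] ++ matrix_seq adj_matrix ++
  matrix_seq pair_matrix ++ matrix_seq domain_matrix.
Proof.
rewrite /encode; congr (_ ++ (_ ++ (_ ++ _))); congr flatten.
by apply: eq_map => i; rewrite !enum_ordSl /= enum_ord0.
Qed.

Lemma size_encode : size (encode I) = 2 + (n * n + (k * 2 + k * n)).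
Proof. by rewrite encodeE !size_cat !size_matrix. Qed.

Let w := nth 0 (encode I).

Lemma encode_adj (u v : 'I_n) : w (2 + (u * n + v)) = adj u v.
Proof.
rewrite /w encodeE /= nth_cat size_matrix.
have := ltn_ord u; have := ltn_ord v => lt_v lt_u.
have -> : u * n + v < n * n by nia.
exact: nth_matrix.
Qed.

Lemma encode_pair (i : 'I_k) (b : 'I_2) :
  w (2 + n * n + (i * 2 + b)) = pair_matrix i b.
Proof.
rewrite /w encodeE -[2 + _ + _]addnA /= add0n nth_cat size_matrix.
rewrite ltnNge leq_addr /= addKn.
have := ltn_ord i; have := ltn_ord b => lt_v lt_u.
rewrite nth_cat size_matrix; have -> : i * 2 + b < k * 2 by lia.
exact: nth_matrix.
Qed.

Lemma encode_src (i : 'I_k) : w (2 + n * n + i * 2) = src i.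
Proof. by rewrite -[i * 2]addn0 (encode_pair i ord0). Qed.

Lemma encode_tgt (i : 'I_k) : w (2 + n * n + (i * 2 + 1)) = tgt i.
Proof. by rewrite (encode_pair i (lift ord0 ord0)). Qed.

Lemma encode_domain (i : 'I_k) (v : 'I_n) :
  w (2 + n * n + k * 2 + (i * n + v)) = (v \in domain i).
Proof.
rewrite /w encodeE -[2 + _ + _ + _]addnA -[2 + _ + _]addnA /= add0n.
rewrite nth_cat size_matrix.
rewrite ltnNge leq_addr /= addKn nth_cat size_matrix ltnNge leq_addr /= addKn.
exact: nth_matrix.
Qed.

(** Input values are bounded by the input length, so time polynomial in the
    values is polynomial in the length. *)
Lemma encode_cell_le j : w j <= size (encode I).
Proof.
have n_le : n <= size (encode I) by rewrite size_encode; nia.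
have k_le : k <= size (encode I) by rewrite size_encode; nia.
case: (ltnP j (size (encode I))) => [lt_j|]; last first.
  by move/(nth_default 0); rewrite /w => ->.
have: w j \in encode I by exact: mem_nth.
have bool_le (b : bool) : b <= size (encode I).
  by apply: leq_trans (leq_b1 b) _; rewrite size_encode.
rewrite /encode mem_cat mem_cat mem_cat !inE.
case/or4P=> [/orP[]/eqP->//|/allpairsP[[u v] [_ _ ->]]|/flattenP[r]
  |/allpairsP[[i v] [_ _ ->]]]; rewrite ?bool_le //.
case/mapP=> i _ ->; rewrite !inE => /orP[] /eqP->;
  by apply: leq_trans n_le; exact: ltnW (ltn_ord _).
Qed.

End EncodingCells.

(** * The kernelization as a term *)

(** Cells of the output are described twice: as numbers, for which correctness is
    proved, and below as terms of the same shape, whose values are these numbers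
    by computation.  Truth values are 0 and 1. *)
Section Cells.
Variable w : nat -> nat.

Definition lt_cell a b := 1 - (a + 1 - b).
Definition eq_cell a b := 1 - ((a - b) + (b - a)).
Definition adj_cell u v := w (2 + (u * w 0 + v)).
Definition src_cell i := w (2 + w 0 * w 0 + i * 2).
Definition tgt_cell i := w (2 + w 0 * w 0 + (i * 2 + 1)).
Definition domain_cell i v := w (2 + w 0 * w 0 + w 1 * 2 + (i * w 0 + v)).
Definition cand_cell i x y v := adj_cell x v * adj_cell y v * domain_cell i v.
Definition marked_cell i x y v :=
  cand_cell i x y v * lt_cell (\sum_(u < v) cand_cell i x y u) (4 * w 1).
Definition kept_cell v :=
  1 - (1 - \sum_(i < w 1)
    (eq_cell v (src_cell i) + eq_cell v (tgt_cell i) +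
     (marked_cell i (src_cell i) (tgt_cell i) v +
      (marked_cell i (src_cell i) (src_cell i) v +
       marked_cell i (tgt_cell i) (tgt_cell i) v)))).
Definition rank_cell v := \sum_(u < v) kept_cell u.
(** Cell [j] of the encoding of the induced instance.  The sums range over the
    vertices of the input graph and select those that are kept. *)
Definition output_cell j :=
  let n' := rank_cell (w 0) in
  eq_cell j 0 * n' + eq_cell j 1 * w 1 +
  (\sum_(u < w 0) \sum_(v < w 0) kept_cell u * kept_cell v *
     (eq_cell j (2 + (rank_cell u * n' + rank_cell v)) * adj_cell u v) +
  (\sum_(i < w 1)
     (eq_cell j (2 + n' * n' + i * 2) * rank_cell (src_cell i) +
      eq_cell j (2 + n' * n' + (i * 2 + 1)) * rank_cell (tgt_cell i)) +
   \sum_(i < w 1) \sum_(v < w 0) kept_cell v *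
     (eq_cell j (2 + n' * n' + w 1 * 2 + (i * n' + rank_cell v)) *
      domain_cell i v))).
(** The length of the input.  It is at least that of the output, and cells beyond
    the output are ignored. *)
Definition output_length := 2 + (w 0 * w 0 + (w 1 * 2 + w 1 * w 0)).
End Cells.

Declare Scope term_scope.
Delimit Scope term_scope with T.
Bind Scope term_scope with term.
Notation "a + b" := (TAdd a b) : term_scope.
Notation "a - b" := (TSub a b) : term_scope.
Notation "a * b" := (TMul a b) : term_scope.
Coercion TConst : nat >-> term.
Notation "'x_ i" := (TVar i)
  (at level 8, i at level 2, format "''x_' i") : term_scope.

Definition w0 := TIn 0.
Definition w1 := TIn 1.
(** Bound variables: 0 is the output position, 1 and 2 are the indices of the
    output sums, and ranks, kept vertices and marked vertices bind 3, 4 and 5;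
    arguments are only built from variables that are not captured. *)
Section Terms.
Local Open Scope term_scope.
Definition lt_term (a b : term) : term := 1%N - (a + 1%N - b).
Definition eq_term (a b : term) : term := 1%N - ((a - b) + (b - a)).
Definition adj_term u v := TIn (2%N + (u * w0 + v)).
Definition src_term i := TIn (2%N + w0 * w0 + i * 2%N).
Definition tgt_term i := TIn (2%N + w0 * w0 + (i * 2%N + 1%N)).
Definition domain_term i v := TIn (2%N + w0 * w0 + w1 * 2%N + (i * w0 + v)).
Definition cand_term i x y v := adj_term x v * adj_term y v * domain_term i v.
Definition marked_term i x y v :=
  cand_term i x y v * lt_term (TSum 5 v (cand_term i x y 'x_5)) (4%N * w1).
Definition kept_term v : term :=
  let i := 'x_4 in
  1%N - (1%N - TSum 4 w1
    (eq_term v (src_term i) + eq_term v (tgt_term i) +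
     (marked_term i (src_term i) (tgt_term i) v +
      (marked_term i (src_term i) (src_term i) v +
       marked_term i (tgt_term i) (tgt_term i) v)))).
Definition rank_term v := TSum 3 v (kept_term 'x_3).
Definition output_term :=
  let j := 'x_0 in let i := 'x_1 in let u := 'x_1 in let v := 'x_2 in
  let n' := rank_term w0 in
  eq_term j 0%N * n' + eq_term j 1%N * w1 +
  (TSum 1 w0 (TSum 2 w0 (kept_term u * kept_term v *
     (eq_term j (2%N + (rank_term u * n' + rank_term v)) * adj_term u v))) +
  (TSum 1 w1
     (eq_term j (2%N + n' * n' + i * 2%N) * rank_term (src_term i) +
      eq_term j (2%N + n' * n' + (i * 2%N + 1%N)) * rank_term (tgt_term i)) +
   TSum 1 w1 (TSum 2 w0 (kept_term v *
     (eq_term j (2%N + n' * n' + w1 * 2%N + (i * n' + rank_term v)) *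
      domain_term i v))))).
Definition length_term := 2%N + (w0 * w0 + (w1 * 2%N + w1 * w0)).
End Terms.

Lemma value_output w rho : value w rho output_term = output_cell w (rho 0).
Proof. by []. Qed.

Lemma value_length w rho : value w rho length_term = output_length w.
Proof. by []. Qed.

Lemma lt_cellE a b : lt_cell a b = (a < b).
Proof. by rewrite /lt_cell; case: ltnP; lia. Qed.

Lemma eq_cellE a b : eq_cell a b = (a == b).
Proof. by rewrite /eq_cell; case: eqP; lia. Qed.

Lemma sum_below n (A : {set 'I_n}) (F : nat -> nat) (v : nat) :
    v <= n -> (forall u : 'I_n, F u = (u \in A)) ->
  \sum_(u < v) F u = #|below A v|.
Proof.
move=> le_v FA; rewrite (big_ord_widen _ _ le_v) -sum1_card [RHS]big_mkcond /=.
rewrite big_mkcond /=; apply: eq_bigr => u _.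
by rewrite inE FA; case: (u \in A); case: (u < v).
Qed.

(** * Correctness of the kernelization *)

Section Correct.
Variable I : instance.
Notation n := (nverts (igraph I)).
Notation k := (npairs I).
Notation K := (kernel_set I).
Notation I' := (induced (@terminals_kernel I)).
Let w := nth 0 (encode I).

Lemma adj_cellE (u v : 'I_n) : adj_cell w u v = adj u v.
Proof. exact: encode_adj. Qed.
Lemma src_cellE (i : 'I_k) : src_cell w i = src i.
Proof. exact: encode_src. Qed.
Lemma tgt_cellE (i : 'I_k) : tgt_cell w i = tgt i.
Proof. exact: encode_tgt. Qed.
Lemma domain_cellE (i : 'I_k) (v : 'I_n) : domain_cell w i v = (v \in domain i).
Proof. exact: encode_domain. Qed.

Lemma cand_cellE (i : 'I_k) (x y v : 'I_n) :
  cand_cell w i x y v = (v \in candidates i x y).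
Proof.
by rewrite /cand_cell !adj_cellE domain_cellE inE -!mulnb mulnA.
Qed.

Lemma marked_cellE (i : 'I_k) (x y v : 'I_n) :
  marked_cell w i x y v = (v \in marked i x y).
Proof.
rewrite /marked_cell cand_cellE lt_cellE.
rewrite (sum_below (ltnW (ltn_ord v)) (cand_cellE i x y)).
by rewrite [in RHS]in_set mulnb.
Qed.

Lemma kept_cellE (v : 'I_n) : kept_cell w v = (v \in K).
Proof.
pose b := (0 < \sum_(i < k) (v \in pair_set i : nat)).
transitivity (nat_of_bool b).
  rewrite /b /kept_cell.
  set s := \sum_(i < w 1) _; set s' := \sum_(i < k) _.
  suff e : (0 < s) = (0 < s') by rewrite -e; case: (posnP s); lia.
  apply/negb_inj; rewrite -!eqn0Ngt /s /s' !sum_nat_eq0.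
  apply: eq_forallb => i; rewrite /= src_cellE tgt_cellE !marked_cellE !eq_cellE.
  rewrite !val_eqE eqb0 !in_setU !in_set1.
  by rewrite !addn_eq0 !eqb0 !negb_or.
congr nat_of_bool; rewrite /b lt0n sum_nat_eq0 negb_forall.
apply/existsP/bigcupP => [[i]|[i _ vi]].
  by rewrite /= eqb0 negbK => vi; exists i.
by exists i; rewrite /= eqb0 negbK.
Qed.

Lemma rank_cellE m : m <= n -> rank_cell w m = #|below K m|.
Proof. by move=> le_m; exact: sum_below le_m kept_cellE. Qed.

Lemma rank_cell_size : rank_cell w n = #|K|.
Proof.
rewrite rank_cellE //; congr #|pred_of_set _|.
by apply/setP=> u; rewrite inE ltn_ord andbT.
Qed.

Lemma rank_cell_val (a : 'I_#|K|) : rank_cell w (enum_val a) = a.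
Proof. by rewrite rank_cellE ?card_below_enum_val // ltnW. Qed.

Lemma sum_kept (F : nat -> nat) :
  \sum_(v < n) kept_cell w v * F v = \sum_(a < #|K|) F (enum_val a).
Proof.
rewrite -(big_enum_val (fun v : 'I_n => F v)) /= [RHS]big_mkcond /=.
by apply: eq_bigr => v _; rewrite kept_cellE; case: (_ \in _); rewrite ?mul1n.
Qed.

Lemma output_cellE j : output_cell w j = nth 0 (encode I') j.
Proof.
rewrite encodeE -cell_from0 !cell_from_cat !cell_from_matrix !size_matrix /= !add0n.
rewrite /output_cell !eq_cellE.
have -> : rank_cell w (w 0) = #|K| := rank_cell_size.
congr (_ + (_ + (_ + _))).
- rewrite /cell_from subn0 mul1n; case: j => [|[|j]] /=;
    by rewrite ?nth_nil !(mul0n, mul1n, addn0, add0n).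
- pose F u v :=
    eq_cell j (2 + (rank_cell w u * #|K| + rank_cell w v)) * adj_cell w u v.
  transitivity (\sum_(u < n) kept_cell w u * \sum_(v < n) kept_cell w v * F u v).
    apply: eq_bigr => u _; rewrite big_distrr; apply: eq_bigr => v _.
    by rewrite -mulnA.
  rewrite (sum_kept (fun u => \sum_(v < n) kept_cell w v * F u v)).
  apply: eq_bigr => a _; rewrite (sum_kept (F _)); apply: eq_bigr => b _.
  by rewrite /F eq_cellE !rank_cell_val adj_cellE.
- apply: eq_bigr => i _; rewrite !big_ord_recl big_ord0 addn0 /= addn0.
  rewrite !eq_cellE src_cellE tgt_cellE /pair_matrix /=.
  have rs := rank_cell_val (@src I' i); have rt := rank_cell_val (@tgt I' i).
  by rewrite f_src in rs; rewrite f_tgt in rt; rewrite rs rt.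
- apply: eq_bigr => i _.
  pose F v := eq_cell j (2 + #|K| * #|K| + w 1 * 2 + (i * #|K| + rank_cell w v)) *
    domain_cell w i v.
  rewrite (sum_kept F); apply: eq_bigr => b _.
  by rewrite /F eq_cellE rank_cell_val domain_cellE /domain_matrix inE.
Qed.

Lemma output_length_ge : size (encode I') <= output_length w.
Proof.
rewrite size_encode /output_length.
have le_K : #|K| <= n by rewrite -[n in X in _ <= X]card_ord max_card.
by rewrite !leq_add ?leq_mul.
Qed.

End Correct.

Theorem kernelization b : exists f : nat -> nat,
  bigO f (fun k => k ^ 2) /\ admits_kernel split_graph (fun I => problem I b) f.
Proof.
exists (fun k => k * (12 * k + 2)); split.
  by exists 14, 0 => k _; rewrite -mulnn; nia.
have [c [d run]] := table_program_correct length_term output_term.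
exists (table_program length_term output_term), c, d, id => I splitI.
have [||m [st [ex le_m out]]] := run (encode I).
- by rewrite size_encode.
- by move=> i; exact: encode_cell_le.
exists m, st, (induced (@terminals_kernel I)); split; split=> //.
- move=> j lt_j; rewrite out ?value_output ?output_cellE //.
  by rewrite value_length (leq_trans lt_j) // output_length_ge.
- exact: induced_split.
- apply: problem_induced => P solP.
  have [C [S [CS CS0 Cc Si]]] := splitI.
  have inC u : u \in ~: S -> u \in C.
    by have /setP/(_ u) := CS; rewrite !inE => /orP[->//|->].
  by apply: (@solution_kernel I S Si) solP => u v /inC uC /inC vC; exact: Cc.
- exact: card_kernel_set.
Qed.

Theorem corollary5p11 :
  (exists f : nat -> nat, bigO f (fun k => k ^ 2) /\
     admits_kernel split_graph set_restricted_disjoint_paths f) /\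
  (exists f : nat -> nat, bigO f (fun k => k ^ 2) /\
     admits_kernel split_graph set_restricted_totally_disjoint_paths f).
Proof. by split; [exact: (kernelization false) | exact: (kernelization true)]. Qed.
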